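(* Let $F=g+h\circ c$ be the composite function described in the context, with $\mu=L\beta>0$. For any point $x\in\mathbf{R}^d$, the point $\hat x:=\operatorname{prox}_{F/2\mu}(x)=\operatorname{argmin}_z\{F(z)+\mu\|z-x\|^2\}$ satisfies $$\|\hat x-x\|\le\frac{2}{\mu}\|\mathcal{G}_{1/\mu}(x)\|,\qquad F(\hat x)\le F(x),\qquad \operatorname{dist}(0;\partial F(\hat x))\le 4\|\mathcal{G}_{1/\mu}(x)\|.$$
   Context: Setting: $g\colon\mathbf{R}^d\to\mathbf{R}\cup\{+\infty\}$ is proper, closed and convex; $h\colon\mathbf{R}^m\to\mathbf{R}$ is convex and $L$-Lipschitz continuous; $c\colon\mathbf{R}^d\to\mathbf{R}^m$ is $C^1$-smooth with $\|\nabla c(x)-\nabla c(y)\|_{\rm op}\le\beta\|x-y\|$ for all $x,y$. Set $\mu:=L\beta$ and $F(x):=g(x)+h(c(x))$. For $t>0$ define $F_t(z;y):=g(z)+h\big(c(y)+\nabla c(y)(z-y)\big)+\frac{1}{2t}\|z-y\|^2$, $S_t(y):=\operatorname{argmin}_z F_t(z;y)$, and the prox-gradient $\mathcal{G}_t(x):=t^{-1}(x-S_t(x))$. The subdifferential $\partial F(x)$ is the limiting subdifferential, which for this class coincides with the Fréchet subdifferential and is given by $\partial F(x)=\partial g(x)+\nabla c(x)^*\partial h(c(x))$, where $\partial g,\partial h$ are convex subdifferentials. $\operatorname{dist}(0;Q):=\inf_{v\in Q}\|v\|$. The minimizer defining $\hat x$ exists and is unique. *)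

(* Defs.v *)
From HB Require Import structures.
From mathcomp Require Import all_boot all_order all_algebra.
From mathcomp Require Import all_classical all_reals all_analysis.

Set Implicit Arguments.
Unset Strict Implicit.
Unset Printing Implicit Defensive.

Import Order.TTheory GRing.Theory Num.Theory.
Import numFieldNormedType.Exports.

Local Open Scope classical_set_scope.
Local Open Scope ring_scope.

(* The library norm on 'rV[R]_n is the max norm, so the Euclidean structure is
   defined here. The topologies agree, hence the library notions of limit,
   continuity and differentiability are used unchanged. *)
Definition dotp (R : realType) (n : nat) (u v : 'rV[R]_n) : R :=
  \sum_(i < n) u ord0 i * v ord0 i.

Definition enorm (R : realType) (n : nat) (u : 'rV[R]_n) : R :=
  Num.sqrt (dotp u u).

(* Matrices act on row vectors from the right, as the library Jacobian does:
   'd f x v = v *m 'J f x. Thus 'J c x is the transpose of the matrix usually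
   written for the derivative of c at x. *)
Definition opnorm (R : realType) (n m : nat) (A : 'M[R]_(n, m)) : R :=
  sup [set enorm (v *m A) | v in [set v : 'rV[R]_n | enorm v <= 1]].

Definition elipschitz (R : realType) (n : nat) (L : R) (h : 'rV[R]_n -> R)
    : Prop :=
  forall x y, `|h x - h y| <= L * enorm (x - y).

Definition C1_smooth (R : realType) (n m : nat) (c : 'rV[R]_n -> 'rV[R]_m)
    : Prop :=
  (forall x, differentiable c x) /\ continuous (fun x => 'J c x).

Definition proper_fun (T : Type) (R : realType) (g : T -> \bar R) : Prop :=
  (forall x, g x != -oo%E) /\ (exists x, g x != +oo%E).

Definition closed_fun (R : realType) (n : nat) (g : 'rV[R]_n -> \bar R)
    : Prop :=
  closed [set p : 'rV[R]_n * R | (g p.1 <= p.2%:E)%E].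

Definition convex_efun (R : realType) (n : nat) (g : 'rV[R]_n -> \bar R)
    : Prop :=
  forall (x y : 'rV[R]_n) (t : R), 0 < t < 1 ->
    (g (t *: x + (1 - t) *: y)%R <= t%:E * g x + (1 - t)%:E * g y)%E.

(* A chosen minimizer; the value is arbitrary when there is none. *)
Definition argmin (R : realType) (n : nat) (f : 'rV[R]_n -> \bar R)
    : 'rV[R]_n :=
  get [set z | forall w, (f z <= f w)%E].

Definition composite (R : realType) (d m : nat) (g : 'rV[R]_d -> \bar R)
    (h : 'rV[R]_m -> R) (c : 'rV[R]_d -> 'rV[R]_m) (x : 'rV[R]_d) : \bar R :=
  (g x + (h (c x))%:E)%E.

Definition prox_model (R : realType) (d m : nat) (g : 'rV[R]_d -> \bar R)
    (h : 'rV[R]_m -> R) (c : 'rV[R]_d -> 'rV[R]_m) (t : R)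
    (y z : 'rV[R]_d) : \bar R :=
  (g z + (h (c y + (z - y) *m 'J c y))%:E
       + ((2 * t)^-1 * enorm (z - y) ^+ 2)%:E)%E.

Definition prox_point (R : realType) (d m : nat) (g : 'rV[R]_d -> \bar R)
    (h : 'rV[R]_m -> R) (c : 'rV[R]_d -> 'rV[R]_m) (t : R)
    (y : 'rV[R]_d) : 'rV[R]_d :=
  argmin (prox_model g h c t y).

Definition prox_grad (R : realType) (d m : nat) (g : 'rV[R]_d -> \bar R)
    (h : 'rV[R]_m -> R) (c : 'rV[R]_d -> 'rV[R]_m) (t : R)
    (x : 'rV[R]_d) : 'rV[R]_d :=
  t^-1 *: (x - prox_point g h c t x).

(* F y >= F x + <v, y - x> + o(|y - x|) as y -> x, at points of finite value. *)
Definition frechet_subdiff (R : realType) (n : nat) (F : 'rV[R]_n -> \bar R)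
    (x : 'rV[R]_n) : set 'rV[R]_n :=
  [set v | F x \is a fin_num /\
    forall eps : R, 0 < eps -> \forall y \near x,
      (F x + (dotp v (y - x) - eps * enorm (y - x))%:E <= F y)%E].

Definition limiting_subdiff (R : realType) (n : nat) (F : 'rV[R]_n -> \bar R)
    (x : 'rV[R]_n) : set 'rV[R]_n :=
  [set v | F x \is a fin_num /\
    exists (u w : nat -> 'rV[R]_n),
      [/\ forall i, frechet_subdiff F (u i) (w i),
          u @ \oo --> x,
          (F \o u) @ \oo --> F x &
          w @ \oo --> v]].

(* dist(0; Q), equal to +oo for empty Q *)
Definition dist0 (R : realType) (n : nat) (Q : set 'rV[R]_n) : \bar R :=
  ereal_inf [set (enorm v)%:E | v in Q].

(* Main.v *)
Require Import Defs.
From HB Require Import structures.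
From mathcomp Require Import all_boot all_order all_algebra finmap ring lra.
From mathcomp Require Import all_classical all_reals all_analysis.

Import Order.TTheory GRing.Theory Num.Theory.
Import numFieldNormedType.Exports.

Local Open Scope classical_set_scope.
Local Open Scope ring_scope.

(** Write [x^+] for the minimizer of the linearized model
      [m(z) = g(z) + h(c(x) + c'(x)(z - x)) + mu/2 |z - x|^2],
    so that the prox-gradient has norm [mu |x^+ - x|], and [xhat] for the
    minimizer of [Phi(z) = F(z) + mu |z - x|^2].

    Since [h] is [L]-Lipschitz and the Jacobian of [c] is [beta]-Lipschitz,
    replacing [c] by its linearization at any [y] changes [h o c] by at most
    [mu/2 |z - y|^2] ([composite_model_error]).  Two consequences carry the
    proof.  On the one hand, taking [y = x],
      [m(z) <= Phi(z)]   and   [Phi(z) <= m(z) + mu |z - x|^2].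
    On the other hand, comparing [h o c] at the ends of a segment with the
    linearization at an intermediate point shows that [h o c] is convex up to
    [mu/2 |.|^2] ([modulus_convex_of_model]); hence [Phi], like [m], is
    [mu]-strongly convex.  Such a function attains its minimum and grows by
    [mu/2] times the squared distance to the minimizer ([argmin_funD]), so
      [m(x^+) + mu/2 |xhat - x^+|^2 <= m(xhat)],
      [Phi(xhat) + mu/2 |xhat - x^+|^2 <= Phi(x^+)].
    Adding these and inserting the two comparisons cancels all function values
    and leaves [|xhat - x^+| <= |x^+ - x|], hence [|xhat - x| <= 2 |x^+ - x|] by
    the triangle inequality: this is the first claim.  The second one is
    [Phi(xhat) <= Phi(x)].  For the third, minimality of [xhat] gives
      [F(y) >= F(xhat) + <2 mu (x - xhat), y - xhat> - mu |y - xhat|^2],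
    so [2 mu (x - xhat)] is a subgradient of [F] at [xhat]
    ([frechet_subdiff_prox]), and its norm is at most [4 mu |x^+ - x|]. *)

Set Implicit Arguments.
Unset Strict Implicit.

Section ProxLinear.
Context {R : realType}.

(** * Euclidean norm on row vectors *)

Lemma dotp_ge0 n (u : 'rV[R]_n) : 0 <= dotp u u.
Proof. by apply: sumr_ge0 => i _; rewrite -expr2 sqr_ge0. Qed.

Lemma sqr_enorm n (u : 'rV[R]_n) : enorm u ^+ 2 = dotp u u.
Proof. by rewrite sqr_sqrtr ?dotp_ge0. Qed.

Lemma enorm_ge0 n (u : 'rV[R]_n) : 0 <= enorm u.
Proof. exact: sqrtr_ge0. Qed.

Lemma enorm0 n : enorm (0 : 'rV[R]_n) = 0.
Proof.
by rewrite /enorm /dotp big1 ?sqrtr0// => i _; rewrite mxE mul0r.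
Qed.

Lemma le_coord_enorm n (u : 'rV[R]_n) i : `|u ord0 i| <= enorm u.
Proof.
rewrite -sqrtr_sqr ler_wsqrtr// expr2 /dotp (bigD1 i)//= lerDl.
by apply: sumr_ge0 => j _; rewrite -expr2 sqr_ge0.
Qed.

Lemma enorm_eq0 n (u : 'rV[R]_n) : enorm u = 0 -> u = 0.
Proof.
move=> u0; apply/rowP => i; rewrite mxE; apply/normr0_eq0/eqP.
by rewrite -normr_le0 normr_id -u0 le_coord_enorm.
Qed.

Lemma dotpC n (u v : 'rV[R]_n) : dotp u v = dotp v u.
Proof. by apply: eq_bigr => i _; rewrite mulrC. Qed.

Lemma dotpDr n (u v w : 'rV[R]_n) : dotp u (v + w) = dotp u v + dotp u w.
Proof. by rewrite -big_split; apply: eq_bigr => i _; rewrite mxE mulrDr. Qed.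

Lemma dotpZr n a (u v : 'rV[R]_n) : dotp u (a *: v) = a * dotp u v.
Proof.
by rewrite [RHS]mulr_sumr; apply: eq_bigr => i _; rewrite mxE mulrCA.
Qed.

Lemma dotpBr n (u v w : 'rV[R]_n) : dotp u (v - w) = dotp u v - dotp u w.
Proof. by rewrite dotpDr -scaleN1r dotpZr mulN1r. Qed.

Lemma enormZ n a (u : 'rV[R]_n) : enorm (a *: u) = `|a| * enorm u.
Proof.
rewrite -sqrtr_sqr -sqrtrM ?sqr_ge0//; congr Num.sqrt.
by rewrite /dotp mulr_sumr; apply: eq_bigr => i _; rewrite !mxE; ring.
Qed.

Lemma enormB n (u v : 'rV[R]_n) : enorm (u - v) = enorm (v - u).
Proof. by rewrite -opprB -scaleN1r enormZ normrN1 mul1r. Qed.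

(** Cauchy-Schwarz, the triangle inequality and the strong convexity of the squared norm
    are all read off this expansion. *)
Lemma sqr_enorm_lin n (a b : R) (u v : 'rV[R]_n) :
  enorm (a *: u + b *: v) ^+ 2 =
  a ^+ 2 * enorm u ^+ 2 + 2 * a * b * dotp u v + b ^+ 2 * enorm v ^+ 2.
Proof.
rewrite !sqr_enorm /dotp !mulr_sumr -!big_split; apply: eq_bigr => i _ /=.
by rewrite !mxE; ring.
Qed.

(** Cauchy-Schwarz, from the nonnegativity of the squared norm of [|v| u - |u| v]. *)
Lemma dotp_le_enorm n (u v : 'rV[R]_n) : dotp u v <= enorm u * enorm v.
Proof.
have [u0|u0] := eqVneq (enorm u) 0.
  rewrite u0 mul0r (enorm_eq0 u0) /dotp big1// => i _; by rewrite mxE mul0r.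
have [v0|v0] := eqVneq (enorm v) 0.
  rewrite v0 mulr0 (enorm_eq0 v0) /dotp big1// => i _; by rewrite mxE mulr0.
have uv0 : 0 < enorm u * enorm v by rewrite mulr_gt0// lt_def ?u0 ?v0 enorm_ge0.
have := sqr_ge0 (enorm (enorm v *: u + (- enorm u) *: v)).
rewrite sqr_enorm_lin => uv; rewrite -subr_ge0 -(pmulr_rge0 _ uv0).
by move: uv; lra.
Qed.

Lemma ler_enormD n (u v : 'rV[R]_n) : enorm (u + v) <= enorm u + enorm v.
Proof.
have := sqr_enorm_lin 1 1 u v; rewrite !scale1r => uv.
rewrite -ler_sqr ?nnegrE ?addr_ge0 ?enorm_ge0// uv.
by have := dotp_le_enorm u v; lra.
Qed.

Lemma abs_dotp_le n (u v : 'rV[R]_n) : `|dotp u v| <= enorm u * enorm v.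
Proof.
rewrite ler_norml dotp_le_enorm andbT lerNl.
apply: (le_trans _ (_ : dotp u (-1 *: v) <= _)).
  by rewrite dotpZr mulN1r.
by apply: (le_trans (dotp_le_enorm _ _)); rewrite enormZ normrN1 mul1r.
Qed.

Lemma dotp_continuous n (u : 'rV[R]_n) : continuous (dotp u).
Proof.
apply: (@continuous_big _ _ _ _ _ add_continuous) => i _ v.
by apply: (@cvgM _ _ (nbhs v)); [exact: cvg_cst|exact: coord_continuous].
Qed.

Lemma enorm_continuous n : continuous (@enorm R n).
Proof.
move=> v; apply: continuous_comp; last exact: sqrt_continuous.
move: v; apply: (@continuous_big _ _ _ _ _ add_continuous) => i _ v.
by apply: (@cvgM _ _ (nbhs v)); exact: coord_continuous.
Qed.

Lemma enorm_sub_continuous n (x : 'rV[R]_n) :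
  continuous (fun z : 'rV[R]_n => enorm (z - x)).
Proof.
move=> z; apply: (@continuous_comp _ _ _ (fun y : 'rV[R]_n => y - x)).
  by apply: (@cvgB _ _ _ (nbhs z)); [exact: cvg_id|exact: cvg_cst].
exact: enorm_continuous.
Qed.

Lemma near_enorm_lt n (x : 'rV[R]_n) e :
  0 < e -> \forall z \near x, enorm (z - x) < e.
Proof.
move=> e0; have := @enorm_sub_continuous n x x; rewrite /continuous_at subrr enorm0.
move/(@cvgr0Pnorm_lt _ _ _ (nbhs x)) => /(_ _ e0); apply: filterS => y.
by rewrite ger0_norm ?enorm_ge0.
Qed.

Lemma elipschitz_continuous n (L : R) (h : 'rV[R]_n -> R) :
  elipschitz L h -> continuous h.
Proof.
move=> hL x; apply/(@cvgrPdist_lt _ _ _ (nbhs x)) => e e0.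
have L0 : 0 < `|L| + 1 by rewrite ltr_wpDl.
have eL : 0 < e / (`|L| + 1) by rewrite divr_gt0.
apply: filterS (near_enorm_lt x eL) => y; rewrite ltr_pdivlMr// => ye.
apply: (le_lt_trans (hL x y)); apply: le_lt_trans ye.
rewrite enormB mulrC ler_wpM2l ?enorm_ge0//.
by rewrite (le_trans (ler_norm L))// lerDl.
Qed.

(** Coordinates are bounded by the Euclidean norm, so a Euclidean ball is bounded for
    the max norm, which is the one that compactness refers to. *)
Lemma eball_compact n (x : 'rV[R]_n) r : compact [set z | enorm (z - x) <= r].
Proof.
apply: bounded_closed_compact; last first.
  rewrite (_ : [set z | _] = (fun z => enorm (z - x)) @^-1` [set s | s <= r])//.
  apply: preimage_closed; last exact: closed_le.
  by move=> z _; exact: enorm_sub_continuous.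
exists (`|r| + `|x|); split; first exact: num_real.
move=> M rM z /= zr; rewrite -(subrK x z) (le_trans (ler_normD _ _))//.
apply: le_trans (ltW rM); rewrite lerD2r [leLHS]mx_normrE.
apply: bigmax_le => // -[i j] _ /=; rewrite ord1.
by rewrite (le_trans (le_coord_enorm _ _))// (le_trans zr)// ler_norm.
Qed.

(** * Linearization error of a composite function *)

(** The supremum defining [opnorm] is a genuine one: by Cauchy-Schwarz on each column,
    the Frobenius norm of [A] is an upper bound. *)
Lemma opnorm_ubound n m (A : 'M[R]_(n, m)) :
  has_ubound [set enorm (v *m A) | v in [set v : 'rV[R]_n | enorm v <= 1]].
Proof.
exists (Num.sqrt (\sum_j enorm (\row_i A i j) ^+ 2)) => _ [v /= v1 <-].
rewrite ler_wsqrtr//; apply: ler_sum => j _; rewrite -expr2 -real_normK ?num_real//.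
rewrite lerXn2r ?nnegrE ?enorm_ge0//.
have -> : (v *m A) ord0 j = dotp v (\row_i A i j).
  by rewrite mxE; apply: eq_bigr => i _; rewrite mxE.
by rewrite (le_trans (abs_dotp_le _ _))// ler_piMl ?enorm_ge0.
Qed.

Lemma enorm_mulmx_le n m (A : 'M[R]_(n, m)) v :
  enorm (v *m A) <= opnorm A * enorm v.
Proof.
have [v0|v0] := eqVneq (enorm v) 0.
  by rewrite v0 mulr0 (enorm_eq0 v0) mul0mx enorm0.
have {}v0 : 0 < enorm v by rewrite lt_def v0 enorm_ge0.
rewrite -ler_pdivrMr//.
have -> : enorm (v *m A) / enorm v = enorm (((enorm v)^-1 *: v) *m A).
  by rewrite -scalemxAl enormZ mulrC ger0_norm// invr_ge0 ltW.
apply: ub_le_sup; first exact: opnorm_ubound.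
by exists ((enorm v)^-1 *: v) => //=; rewrite enormZ normfV gtr0_norm ?mulVf ?gt_eqF.
Qed.

(** Along a line, the difference quotients of [dotp p o c] are the images under [dotp p]
    of those of [c], and [dotp p] is continuous. *)
Lemma is_derive_dotp_line n m (c : 'rV[R]_n -> 'rV[R]_m) p y v (t : R) :
  differentiable c (y + t *: v) ->
  is_derive t 1 (fun s => dotp p (c (y + s *: v)))
    (dotp p (v *m 'J c (y + t *: v))).
Proof.
move=> c_diff; rewrite -deriveEjacobian//.
have : h^-1 *: (dotp p (c (y + (h *: 1 + t) *: v)) - dotp p (c (y + t *: v)))
    @[h --> 0^'] --> dotp p ('D_v c (y + t *: v)).
  have -> : (fun h : R => h^-1 *:
      (dotp p (c (y + (h *: 1 + t) *: v)) - dotp p (c (y + t *: v)))) =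
    dotp p \o (fun h : R => h^-1 *:
      ((c \o shift (y + t *: v)) (h *: v) - c (y + t *: v))).
    apply/funext => h; apply: etrans (esym (dotpZr _ _ _)).
    rewrite dotpBr /=.
    by rewrite [h *: 1]mulr1 scalerDl addrCA.
  apply: (@cvg_comp _ _ _ _ (dotp p) _ (nbhs ('D_v c (y + t *: v)))).
    exact: (diff_derivable (v := v) c_diff).
  exact: dotp_continuous.
move=> df; split; first by apply/cvg_ex; eexists; exact: df.
exact: cvg_lim df.
Qed.

(** The mean value theorem only holds for scalar functions, so the error vector [p] is
    tested against itself along the segment from [y] to [z]: the resulting function [f]
    has nonpositive derivative, and [f 1 <= f 0] reads
    [|p|^2 <= beta/2 |p| |z - y|^2]. *)
Lemma taylor_lipschitz_jacobian n m (c : 'rV[R]_n -> 'rV[R]_m) (beta : R) :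
    (forall x, differentiable c x) ->
    (forall x y, opnorm ('J c x - 'J c y) <= beta * enorm (x - y)) ->
  forall y z, 0 <= beta ->
    enorm (c z - (c y + (z - y) *m 'J c y)) <= beta / 2 * enorm (z - y) ^+ 2.
Proof.
move=> c_diff J_lip y z beta0.
set v := z - y; set p := c z - _; set D := enorm v.
have [p0|p0] := eqVneq (enorm p) 0.
  by rewrite p0 mulr_ge0 ?sqr_ge0 ?divr_ge0.
have {}p0 : 0 < enorm p by rewrite lt_def p0 enorm_ge0.
pose q t := y + t *: v.
(* The multiples of [id] are spelled out as functions so that the rules for derivatives
   of sums and products apply. *)
pose f := (fun t : R => dotp p (c (q t))) - dotp p (v *m 'J c y) \*: (id : R -> R)
          - (beta / 2 * enorm p * D ^+ 2) \*: (id : R -> R) ^+ 2.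
pose df t := dotp p (v *m ('J c (q t) - 'J c y))
             - beta * enorm p * D ^+ 2 * t.
have fd (t : R) : is_derive t 1 f (df t).
  have cd := is_derive_dotp_line p (c_diff (q t)).
  have idd := is_derive_id t (1 : R).
  have fd := is_deriveB (is_deriveB cd (is_deriveZ (dotp p (v *m 'J c y)) idd))
    (is_deriveZ (beta / 2 * enorm p * D ^+ 2) (is_deriveX 2 idd)).
  have dfE a b e r : a - b * 1 - beta / 2 * e * r * (2 * t * 1)
      = a - b - beta * e * r * t by field.
  by apply: is_derive_eq fd _; rewrite /df mulmxBr dotpBr -dfE.
have fc : {within `[0, 1], continuous f}.
  apply: continuous_subspaceT => t; apply: differentiable_continuous.
  by apply/derivable1_diffP; have [] := fd t.
have [t t01] := MVT ltr01 (fun t _ => fd t) fc.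
rewrite subr0 mulr1 => f10.
have : df t <= 0.
  rewrite /df subr_le0 (le_trans (dotp_le_enorm _ _))//.
  move: t01; rewrite in_itv/= => /andP[t0 t1].
  have -> : beta * enorm p * D ^+ 2 * t = enorm p * (beta * (t * D) * D) by ring.
  rewrite ler_wpM2l ?enorm_ge0// (le_trans (enorm_mulmx_le _ _))//.
  rewrite ler_wpM2r ?enorm_ge0// (le_trans (J_lip _ _))//.
  by rewrite /q [y + _]addrC addrK enormZ gtr0_norm.
rewrite -f10 /f /q !fctE /= scale1r scale0r addr0 /GRing.scale/=.
have -> : y + v = z by rewrite /v addrC subrK.
have : enorm p ^+ 2 = dotp p (c z) - dotp p (c y) - dotp p (v *m 'J c y).
  rewrite sqr_enorm {2}/p dotpBr dotpDr; ring.
move=> pE fle; rewrite -(ler_pM2l p0); move: pE fle; lra.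
Qed.

(** Makes the linearized composite term continuous, by the lemma on Lipschitz functions. *)
Lemma elipschitz_affine n m L (h : 'rV[R]_m -> R) b y (A : 'M[R]_(n, m)) :
  elipschitz L h ->
  elipschitz (`|L| * opnorm A) (fun z => h (b + (z - y) *m A)).
Proof.
move=> h_lip z w; apply: le_trans (h_lip _ _) _.
have -> : b + (z - y) *m A - (b + (w - y) *m A) = (z - w) *m A.
  by rewrite opprD addrACA subrr add0r -mulmxBl opprB addrA subrK.
apply: (@le_trans _ _ (`|L| * enorm ((z - w) *m A))).
  by rewrite ler_wpM2r ?enorm_ge0 ?ler_norm.
by rewrite -mulrA ler_wpM2l ?enorm_mulmx_le.
Qed.

(** When [L < 0], the Lipschitz condition itself makes the left-hand side nonpositive;
    when [L > 0], [beta] is positive and the Taylor estimate applies. *)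
Lemma composite_model_error n m (h : 'rV[R]_m -> R) (c : 'rV[R]_n -> 'rV[R]_m)
    (L beta : R) :
    elipschitz L h -> (forall x, differentiable c x) ->
    (forall x y, opnorm ('J c x - 'J c y) <= beta * enorm (x - y)) ->
    0 < L * beta ->
  forall y z, `|h (c z) - h (c y + (z - y) *m 'J c y)|
    <= L * beta / 2 * enorm (z - y) ^+ 2.
Proof.
move=> h_lip c_diff J_lip mu0 y z; apply: le_trans (h_lip _ _) _.
have [L0|L0] := leP L 0.
  apply: (@le_trans _ _ 0); first by rewrite mulr_le0_ge0 ?enorm_ge0.
  by rewrite mulr_ge0 ?sqr_ge0// divr_ge0// ltW.
have -> : L * beta / 2 * enorm (z - y) ^+ 2 = L * (beta / 2 * enorm (z - y) ^+ 2).
  by rewrite !mulrA.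
rewrite ler_wpM2l ?(ltW L0)//.
by apply: taylor_lipschitz_jacobian => //; rewrite -(pmulr_rge0 _ L0) ltW.
Qed.

(** * Strong and weak convexity *)

(** The modulus may be negative: [f] is [(- mu)]-convex when adding [mu/2 |.|^2] makes it
    convex.  Keeping the sign free makes strong and weak convexity add up. *)
Definition modulus_convex n (a : R) (f : 'rV[R]_n -> R) : Prop :=
  forall x y t, 0 < t < 1 ->
    f (t *: x + (1 - t) *: y) + a / 2 * (t * (1 - t)) * enorm (x - y) ^+ 2
    <= t * f x + (1 - t) * f y.

Definition strongly_convex n (a : R) (f : 'rV[R]_n -> \bar R) : Prop :=
  forall x y t, 0 < t < 1 ->
    (f (t *: x + (1 - t) *: y)%R + (a / 2 * (t * (1 - t)) * enorm (x - y) ^+ 2)%:E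
     <= t%:E * f x + (1 - t)%:E * f y)%E.

Lemma modulus_convexD n a b (f g : 'rV[R]_n -> R) :
  modulus_convex a f -> modulus_convex b g ->
  modulus_convex (a + b) (fun z => f z + g z).
Proof.
move=> fa gb x y t t01; have := lerD (fa x y t t01) (gb x y t t01); lra.
Qed.

Lemma modulus_convex_sqr n a (x0 : 'rV[R]_n) :
  modulus_convex (2 * a) (fun z => a * enorm (z - x0) ^+ 2).
Proof.
move=> x y t _.
have -> : t *: x + (1 - t) *: y - x0 = t *: (x - x0) + (1 - t) *: (y - x0).
  by apply/rowP => i; rewrite !mxE; ring.
have -> : x - y = 1 *: (x - x0) + (-1) *: (y - x0).
  by apply/rowP => i; rewrite !mxE; ring.
by rewrite !sqr_enorm_lin; lra.
Qed.

Lemma convex_function_segment n (h : 'rV[R]_n -> R) :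
  convex_function setT h -> forall x y t, 0 < t < 1 ->
  h (t *: x + (1 - t) *: y) <= t * h x + (1 - t) * h y.
Proof.
move=> h_convex x y t /andP[t0 t1].
have t01 : Itv.spec (@Itv.num_sem R) (Itv.Real `[0%Z, 1%Z]) t.
  by rewrite /= /Itv.num_sem/= in_itv/= !ltW ?num_real.
by have := h_convex (Itv.mk t01) x y; rewrite !inE => /(_ I I).
Qed.

Lemma modulus_convex_affine n m (h : 'rV[R]_m -> R) (A : 'M[R]_(n, m)) b y :
  convex_function setT h -> modulus_convex 0 (fun z => h (b + (z - y) *m A)).
Proof.
move=> h_convex u v t t01; rewrite !mul0r addr0.
have -> : b + (t *: u + (1 - t) *: v - y) *m A =
    t *: (b + (u - y) *m A) + (1 - t) *: (b + (v - y) *m A).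
  have -> : t *: u + (1 - t) *: v - y = t *: (u - y) + (1 - t) *: (v - y).
    by apply/rowP => i; rewrite !mxE; ring.
  rewrite mulmxDl -!scalemxAl.
  by move: (_ *m A) (_ *m A) => r s; apply/rowP => i; rewrite !mxE; ring.
exact: convex_function_segment.
Qed.

(** At [w = t x + (1 - t) y], the linearization is affine and [h] is convex, so
    [h (c w)] is at most the average of the model values at [x] and [y].  The model
    errors there average to [mu/2 (t (1 - t)^2 + (1 - t) t^2) |x - y|^2], which is
    [mu/2 t (1 - t) |x - y|^2]. *)
Lemma modulus_convex_of_model n m (h : 'rV[R]_m -> R) (c : 'rV[R]_n -> 'rV[R]_m) mu :
  convex_function setT h ->
  (forall y z, `|h (c z) - h (c y + (z - y) *m 'J c y)|
     <= mu / 2 * enorm (z - y) ^+ 2) ->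
  modulus_convex (- mu) (h \o c).
Proof.
move=> h_convex model x y t t01 /=; set w := t *: x + _.
have := modulus_convex_affine ('J c w) (c w) w h_convex x y t01.
rewrite -/w subrr mul0mx addr0 !mul0r addr0.
have := model w x; have := model w y.
rewrite !ler_norml => /andP[my _] /andP[mx _]; move: mx my.
have -> : enorm (x - w) ^+ 2 = (1 - t) ^+ 2 * enorm (x - y) ^+ 2.
  have -> : x - w = (1 - t) *: (x - y) by apply/rowP => i; rewrite !mxE; ring.
  by rewrite enormZ exprMn real_normK ?num_real.
have -> : enorm (y - w) ^+ 2 = t ^+ 2 * enorm (x - y) ^+ 2.
  have -> : y - w = - t *: (x - y) by apply/rowP => i; rewrite !mxE; ring.
  by rewrite enormZ exprMn real_normK ?num_real// sqrrN.
case/andP: t01 => t0 t1; have t1' : 0 < 1 - t by rewrite subr_gt0.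
rewrite -(ler_pM2l t0) => mx; rewrite -(ler_pM2l t1') => my hw.
by move: mx my hw; lra.
Qed.

Lemma strongly_convexD n a (g : 'rV[R]_n -> \bar R) (phi : 'rV[R]_n -> R) :
  (forall x, g x != -oo%E) -> convex_efun g -> modulus_convex a phi ->
  strongly_convex a (fun z => g z + (phi z)%:E)%E.
Proof.
move=> gNy g_convex phi_a x y t t01; case/andP: (t01) => t0 t1.
have t1' : 0 < 1 - t by rewrite subr_gt0.
have gz := g_convex x y t t01; have pz := phi_a x y t t01.
move: gz (gNy x) (gNy y) (gNy (t *: x + (1 - t) *: y)).
case: (g x) => [r| |]//; case: (g y) => [s| |]// => gz _ _ gNz; last 3 first.
- by rewrite /= [in X in (_ <= X)%E]gt0_muley ?lte_fin// addey ?leey.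
- by rewrite [X in (_ <= X + _)%E]gt0_muley ?lte_fin// addye ?leey.
- by rewrite !gt0_muley ?lte_fin// leey.
move: gz gNz; case: (g _) => [z| |]//; rewrite -?EFinD -?EFinM -?EFinD ?lee_fin.
by lra.
Qed.

(** * Existence and growth of minimizers *)

(** The epigraph of the sum is the preimage of that of [g] under the shear
    [(z, r) |-> (z, r - phi z)]. *)
Lemma closed_funD n (g : 'rV[R]_n -> \bar R) (phi : 'rV[R]_n -> R) :
  closed_fun g -> continuous phi -> closed_fun (fun z => g z + (phi z)%:E)%E.
Proof.
move=> g_closed phi_cont; rewrite /closed_fun.
rewrite (_ : [set _ | _] = (fun p : 'rV[R]_n * R => (p.1, p.2 - phi p.1)) @^-1`
    [set p : 'rV[R]_n * R | (g p.1 <= p.2%:E)%E]).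
  apply: preimage_closed g_closed => p _.
  apply: (@cvg_pair _ _ _ (nbhs p) (nbhs p.1) (nbhs (p.2 - phi p.1))).
    exact: cvg_fst.
  apply: (@cvgB _ _ _ (nbhs p)); first exact: cvg_snd.
  by apply: (@continuous_comp _ _ _ fst phi); [exact: cvg_fst|exact: phi_cont].
apply/funext => -[z r] /=; apply/propext; rewrite EFinB.
by rewrite leeBrDr.
Qed.

(** If no point of [K] were minimal, the sets where [f] exceeds [f w], for [w] in [K],
    would form an open cover of [K]; the best point of a finite subcover would then
    be uncovered. *)
Lemma closed_fun_min n (f : 'rV[R]_n -> \bar R) (K : set 'rV[R]_n) x0 :
  closed_fun f -> (forall z, f z != -oo%E) -> compact K -> K x0 ->
  exists2 z, K z & forall w, K w -> (f z <= f w)%E.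
Proof.
move=> f_closed fNy; rewrite compact_cover => K_cover Kx0.
apply: contrapT => noz.
have lt_ex z : K z -> exists2 w, K w & (f w < f z)%E.
  move=> Kz; apply: contrapT => now; apply: noz; exists z => // w Kw.
  by rewrite leNgt; apply/negP => wz; apply: now; exists w.
have op w : K w -> open [set z | (f w < f z)%E].
  move=> _; case fw : (f w) => [r| |].
  - rewrite (_ : [set z | _] = ~` ((fun z => (z, r)) @^-1`
      [set p : 'rV[R]_n * R | (f p.1 <= p.2%:E)%E])).
      apply: closed_openC; apply: preimage_closed f_closed => z _.
      by apply: (@cvg_pair _ _ _ (nbhs z) (nbhs z) (nbhs r)); [exact: cvg_id|exact: cvg_cst].
    by apply/seteqP; split => z /=; rewrite ltNge => /negP.
  - rewrite (_ : [set z | _] = set0); first exact: open0.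
    by apply/seteqP; split => z //=; rewrite ltNge leey.
  - by have := fNy w; rewrite fw.
have [|D DK Dcover] := K_cover _ K (fun w => [set z | (f w < f z)%E]) op.
  by move=> z /lt_ex[w Kw wz]; exists w.
have [w0 w0D _] := Dcover _ Kx0.
have [j _ jmin] :=
  @arg_minP _ _ _ [` w0D]%fset xpredT (fun i : D => f (val i)) isT.
have Kj : K (val j) by have := DK _ (valP j); rewrite inE.
have [w wD /=] := Dcover _ Kj.
by rewrite ltNge (jmin [` wD]%fset isT).
Qed.

(** Compare [z] with the points [t w + (1 - t) z] of the segment towards [w], divide
    by [t] and let [t] tend to 0. *)
Lemma strongly_convex_growth n a (f : 'rV[R]_n -> \bar R) z :
    strongly_convex a f -> f z \is a fin_num ->
    (forall w, (f z <= f w)%E) ->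
  forall w, (f z + (a / 2 * enorm (w - z) ^+ 2)%:E <= f w)%E.
Proof.
move=> f_sc fz_fin zmin w.
have [r fz] : exists r, f z = r%:E by exists (fine (f z)); rewrite fineK.
have := zmin w; case fw : (f w) => [s| |]; last 2 first.
- by rewrite !leey.
- by rewrite fz leeNy_eq.
move=> _; rewrite fz -EFinD lee_fin.
have key t : 0 < t < 1 -> (1 - t) * (a / 2 * enorm (w - z) ^+ 2) <= s - r.
  move=> t01; have := f_sc w z t t01; case/andP: (t01) => t0 _.
  have /le_trans := leeD2r (a / 2 * (t * (1 - t)) * enorm (w - z) ^+ 2)%:E
    (zmin (t *: w + (1 - t) *: z)).
  move=> /[apply]; rewrite fz fw -!EFinM -!EFinD lee_fin => le_t.
  by rewrite -(ler_pM2l t0); move: le_t; lra.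
have rs : 0 <= s - r by rewrite subr_ge0 -lee_fin -fz -fw.
rewrite -lerBrDl leNgt; apply/negP => lt_sr.
set q := a / 2 * _ in key lt_sr *; have q0 : 0 < q by exact: le_lt_trans lt_sr.
clearbody q.
(* With this [t], [(1 - t) q] is the midpoint of [s - r] and [q], still above [s - r]. *)
pose t := (q - (s - r)) / (2 * q).
have t01 : 0 < t < 1.
  apply/andP; split; first by apply: divr_gt0; lra.
  by rewrite ltr_pdivrMr; lra.
have tq : t * q = (q - (s - r)) / 2 by rewrite /t; field; rewrite gt_eqF.
by have := key _ t01; lra.
Qed.

(** [f] is bounded below by some [m] on the unit ball
    around a point [x0] of its domain, and for [w] at distance [D > 1] from [x0] the
    convexity inequality at the point of the unit sphere on the segment from [x0] to [w]
    gives [f w >= f x0 + D (m - f x0 + a/2 (D - 1))].  Hence points outside a large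
    ball do no better than [x0], and compactness applies inside it. *)
Lemma strongly_convex_min_ex n a (f : 'rV[R]_n -> \bar R) :
    0 < a -> proper_fun f -> closed_fun f -> strongly_convex a f ->
  exists2 z, f z \is a fin_num & forall w, (f z <= f w)%E.
Proof.
move=> a0 [fNy [x0 fx0]] f_closed f_sc.
have fin w : f w <> +oo%E -> exists r, f w = r%:E.
  by move=> fw; exists (fine (f w)); rewrite fineK// fin_numE fNy; apply/eqP.
have [r0 {}fx0] := fin _ (elimN eqP fx0).
have ballx0 r : 0 <= r -> [set z | enorm (z - x0) <= r] x0.
  by move=> r_ge0; rewrite /= subrr enorm0.
have [z1 _ z1_min] :=
  closed_fun_min f_closed fNy (@eball_compact n x0 1) (ballx0 _ ler01).
have [m fz1] : exists m, f z1 = m%:E.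
  apply: fin => fz1; have := z1_min x0 (ballx0 _ ler01).
  by rewrite fz1 fx0 leye_eq.
have m_le : m <= r0 by rewrite -lee_fin -fz1 -fx0 z1_min//; exact: ballx0.
(* The radius at which the bound on [f w] reaches [f x0]. *)
pose rho := 1 + 2 / a * (r0 - m).
have rho1 : 1 <= rho by rewrite lerDl mulr_ge0 ?subr_ge0 ?divr_ge0// ltW.
have rho0 : 0 <= rho by exact: le_trans rho1.
have [z _ z_min] :=
  closed_fun_min f_closed fNy (@eball_compact n x0 rho) (ballx0 _ rho0).
have zx0 : (f z <= f x0)%E by apply: z_min; exact: ballx0.
exists z => [|w].
  by rewrite fin_numE fNy; apply/eqP => fz; move: zx0; rewrite fz fx0 leye_eq.
have [wrho|rhow] := leP (enorm (w - x0)) rho; first exact: z_min.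
apply: le_trans zx0 _.
case: (eqVneq (f w) +oo%E) => [->|/eqP/fin[s fw]]; first by rewrite leey.
set D := enorm (w - x0) in rhow.
have D1 : 1 < D by exact: le_lt_trans rhow.
have D0 : 0 < D by exact: lt_trans D1.
have t01 : 0 < D^-1 < 1 by rewrite invr_gt0 D0 invf_lt1.
have := f_sc w x0 _ t01.
have /z1_min : enorm (D^-1 *: w + (1 - D^-1) *: x0 - x0) <= 1.
  have -> : D^-1 *: w + (1 - D^-1) *: x0 - x0 = D^-1 *: (w - x0).
    by apply/rowP => i; rewrite !mxE; ring.
  by rewrite enormZ gtr0_norm ?invr_gt0// mulVf ?gt_eqF.
move=> /(leeD2r _)/le_trans/[apply].
rewrite fz1 fw fx0 -!EFinM -!EFinD !lee_fin -/D.
move=> le_s.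
have {le_s} : m * D + a / 2 * (D - 1) * D <= s + (D - 1) * r0.
  have -> : m * D + a / 2 * (D - 1) * D =
      D * (m + a / 2 * (D^-1 * (1 - D^-1)) * D ^+ 2) by field; rewrite gt_eqF.
  have -> : s + (D - 1) * r0 = D * (D^-1 * s + (1 - D^-1) * r0).
    by field; rewrite gt_eqF.
  by rewrite ler_pM2l.
have rm : r0 - m <= a / 2 * (D - 1).
  have -> : r0 - m = a / 2 * (rho - 1) by rewrite /rho; field; rewrite gt_eqF.
  by rewrite ler_pM2l ?divr_gt0// lerD2r ltW.
have {}rm : D * (r0 - m) <= D * (a / 2 * (D - 1)) by rewrite ler_pM2l.
by lra.
Qed.

Lemma argmin_spec n a (f : 'rV[R]_n -> \bar R) :
    0 < a -> proper_fun f -> closed_fun f -> strongly_convex a f ->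
  f (argmin f) \is a fin_num /\
  forall w, (f (argmin f) + (a / 2 * enorm (w - argmin f) ^+ 2)%:E <= f w)%E.
Proof.
move=> a0 f_proper f_closed f_sc.
have [z z_fin z_min] := strongly_convex_min_ex a0 f_proper f_closed f_sc.
have /getPex : exists z, forall w, (f z <= f w)%E by exists z.
rewrite -/(argmin f) => min.
have fin : f (argmin f) \is a fin_num.
  have -> // : f (argmin f) = f z by apply: le_anti; rewrite min z_min.
by split=> //; exact: strongly_convex_growth f_sc fin min.
Qed.

(** Packaged for both minimizations of the theorem, where the real-valued part [phi]
    supplies all of the strong convexity. *)
Lemma argmin_funD n a (g : 'rV[R]_n -> \bar R) (phi : 'rV[R]_n -> R) :
    proper_fun g -> closed_fun g -> convex_efun g ->
    0 < a -> continuous phi -> modulus_convex a phi ->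
  let z := argmin (fun w => g w + (phi w)%:E)%E in
  g z \is a fin_num /\
  forall w, (g z + (phi z + a / 2 * enorm (w - z) ^+ 2)%:E
             <= g w + (phi w)%:E)%E.
Proof.
move=> [gNy [w0 gw0]] g_closed g_convex a0 phi_cont phi_a z.
have f_proper : proper_fun (fun w => g w + (phi w)%:E)%E.
  split=> [w|]; first by have := gNy w; case: (g w).
  by exists w0; have := gNy w0; move: gw0; case: (g w0).
have [] := argmin_spec a0 f_proper (closed_funD g_closed phi_cont)
  (strongly_convexD gNy g_convex phi_a).
rewrite -/z fin_numD => /andP[gz _] zmin; split=> // w.
by have := zmin w; rewrite -addeA -EFinD.
Qed.

(** * Subgradients at proximal points *)

(** The proximal inequality is a quadratic lower bound on [F] at [z] with slope
    [2 mu (x - z)]; its defect [mu |y - z|^2] is [o(|y - z|)]. *)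
Lemma frechet_subdiff_prox n mu (F : 'rV[R]_n -> \bar R) x z :
    0 <= mu -> F z \is a fin_num ->
    (forall w, F z + (mu * enorm (z - x) ^+ 2)%:E
               <= F w + (mu * enorm (w - x) ^+ 2)%:E)%E ->
  frechet_subdiff F z ((2 * mu) *: (x - z)).
Proof.
move=> mu0 Fz z_min; split=> // e e0.
(* Within [e / (mu + 1)] of [z], the defect [mu |y - z|^2] is at most [e |y - z|]. *)
have d0 : 0 < e / (mu + 1) by rewrite divr_gt0// ltr_wpDl.
apply: filterS (near_enorm_lt z d0) => y.
rewrite ltr_pdivlMr ?ltr_wpDl// => ye.
have [r Fr] : exists r, F z = r%:E by exists (fine (F z)); rewrite fineK.
have := z_min y; rewrite Fr; case: (F y) => [s| |]//; last by move=> _; rewrite leey.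
rewrite -!EFinD !lee_fin.
have -> : y - x = 1 *: (y - z) + (-1) *: (x - z).
  by apply/rowP => i; rewrite !mxE; ring.
rewrite sqr_enorm_lin [enorm (z - x)]enormB.
have -> : dotp ((2 * mu) *: (x - z)) (y - z) = 2 * mu * dotp (y - z) (x - z).
  by rewrite dotpC dotpZr.
have : mu * enorm (y - z) ^+ 2 <= e * enorm (y - z).
  rewrite expr2 mulrA ler_wpM2r ?enorm_ge0//.
  by have := enorm_ge0 (y - z); lra.
lra.
Qed.

Lemma frechet_sub_limiting n (F : 'rV[R]_n -> \bar R) x :
  frechet_subdiff F x `<=` limiting_subdiff F x.
Proof.
move=> v Fv; split; first by case: Fv.
by exists (fun=> x), (fun=> v); split => //; exact: cvg_cst.
Qed.

End ProxLinear.

(** * Step length of the prox-gradient and the proximal point *)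

Theorem mainTheorem2 (R : realType) (d m : nat)
    (g : 'rV[R]_d -> \bar R) (h : 'rV[R]_m -> R)
    (c : 'rV[R]_d -> 'rV[R]_m) (L beta mu : R)
    (g_proper : proper_fun g) (g_closed : closed_fun g)
    (g_convex : convex_efun g)
    (h_convex : convex_function setT h) (h_lip : elipschitz L h)
    (c_C1 : C1_smooth c)
    (Jc_lip : forall x y, opnorm ('J c x - 'J c y) <= beta * enorm (x - y))
    (mu_def : mu = L * beta) (mu_gt0 : 0 < mu) (x : 'rV[R]_d) :
  let F := composite g h c in
  let xhat := argmin (fun z => (F z + (mu * enorm (z - x) ^+ 2)%:E)%E) in
  [/\ enorm (xhat - x) <= 2 / mu * enorm (prox_grad g h c mu^-1 x),
      (F xhat <= F x)%E &
      (dist0 (limiting_subdiff F xhat)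
        <= (4 * enorm (prox_grad g h c mu^-1 x))%:E)%E].
Proof.
move=> F xhat.
have [c_diff _] := c_C1.
have mu_ge0 := ltW mu_gt0.
have mu2_ge0 : 0 <= mu / 2 by rewrite divr_ge0.
have model : forall y z, `|h (c z) - h (c y + (z - y) *m 'J c y)|
    <= mu / 2 * enorm (z - y) ^+ 2.
  by rewrite mu_def in mu_gt0 *; exact: composite_model_error Jc_lip _.
(* [g + phi] is the function minimized by [xhat], and [g + psi] the prox-linear model. *)
pose phi z := h (c z) + mu * enorm (z - x) ^+ 2.
pose psi z := h (c x + (z - x) *m 'J c x) + mu / 2 * enorm (z - x) ^+ 2.
have sqr_cont a : continuous (fun z : 'rV[R]_d => a * enorm (z - x) ^+ 2).
  move=> z; apply: (@cvgM _ _ (nbhs z)); first exact: cvg_cst.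
  by rewrite expr2; apply: (@cvgM _ _ (nbhs z)); exact: enorm_sub_continuous.
have phi_cont : continuous phi.
  move=> z; apply: (@cvgD _ _ _ (nbhs z)); last exact: sqr_cont.
  apply: (@continuous_comp _ _ _ c h).
    exact: differentiable_continuous.
  exact: elipschitz_continuous h_lip _.
have psi_cont : continuous psi.
  move=> z; apply: (@cvgD _ _ _ (nbhs z)); last exact: sqr_cont.
  exact: elipschitz_continuous (elipschitz_affine _ _ _ h_lip) _.
have phi_mu : modulus_convex mu phi.
  have := modulus_convexD (modulus_convex_of_model h_convex model)
    (modulus_convex_sqr mu x).
  by have -> : - mu + 2 * mu = mu by ring.
have psi_mu : modulus_convex mu psi.
  have := modulus_convexD (modulus_convex_affine ('J c x) (c x) x h_convex)
    (modulus_convex_sqr (mu / 2) x).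
  by have -> : 0 + 2 * (mu / 2) = mu by field.
have xhatE : xhat = argmin (fun z => g z + (phi z)%:E)%E.
  by congr argmin; apply/funext => z; rewrite /F /composite -addeA -EFinD.
have [ghat hat_min] := argmin_funD g_proper g_closed g_convex mu_gt0 phi_cont phi_mu.
have [gplus plus_min] := argmin_funD g_proper g_closed g_convex mu_gt0 psi_cont psi_mu.
rewrite -xhatE in ghat hat_min.
set xplus := argmin _ in gplus plus_min.
have xplusE : prox_point g h c mu^-1 x = xplus.
  congr argmin; apply/funext => z; rewrite /prox_model -addeA -EFinD.
  by congr (_ + (_ + _ * _)%:E)%E; field; rewrite gt_eqF.
(* The growth of both functions at their minimizers, added up, with the model error
   at [xhat] and at [xplus]. *)
have hat_plus : enorm (xhat - xplus) <= enorm (xplus - x).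
  have := hat_min xplus; have := plus_min xhat.
  have := model x xhat; have := model x xplus.
  rewrite -[g xhat]fineK// -[g xplus]fineK// -!EFinD !lee_fin /phi /psi.
  rewrite [enorm (xplus - xhat)]enormB !ler_norml.
  move=> /andP[_ mplus] /andP[mhat _] plus_le hat_le.
  rewrite -ler_sqr ?nnegrE ?enorm_ge0// -(ler_pM2l mu_gt0).
  by move: mplus mhat plus_le hat_le; lra.
have hat_x : enorm (xhat - x) <= 2 * enorm (xplus - x).
  have := ler_enormD (xhat - xplus) (xplus - x).
  by rewrite subrKA; lra.
have gradE : enorm (prox_grad g h c mu^-1 x) = mu * enorm (xplus - x).
  by rewrite /prox_grad xplusE invrK enormZ gtr0_norm// enormB.
rewrite gradE; split.
- have -> : 2 / mu * (mu * enorm (xplus - x)) = 2 * enorm (xplus - x).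
    by field; rewrite gt_eqF.
  exact: hat_x.
- have := hat_min x; rewrite /F /composite /phi subrr enorm0 expr0n mulr0 addr0.
  apply: le_trans; rewrite -[g xhat]fineK// -!EFinD lee_fin lerD2l -addrA lerDl.
  by rewrite addr_ge0// mulr_ge0// sqr_ge0.
have Fhat : F xhat \is a fin_num by rewrite fin_numD ghat.
apply: (@le_trans _ _ (enorm ((2 * mu) *: (x - xhat)))%:E).
  apply: ereal_inf_lbound; exists ((2 * mu) *: (x - xhat)) => //.
  apply/frechet_sub_limiting/frechet_subdiff_prox => //.
  move=> w; rewrite /F /composite -!addeA -!EFinD; apply: le_trans (hat_min w).
  by rewrite leeD2l// lee_fin lerDl mulr_ge0// sqr_ge0.
rewrite lee_fin enormZ gtr0_norm ?mulr_gt0// enormB.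
have : mu * enorm (xhat - x) <= mu * (2 * enorm (xplus - x)) by rewrite ler_pM2l.
by lra.
Qed.
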